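(* Let $X$ be an infinitely divisible random variable taking values in $I_0=\{0,1,2,\ldots\}$ that satisfies $P\{X=0\}>0$, or any one of the following statements equivalent to it: (i) the support of $X$ coincides with the support of its components $X_{in}$ for every integer $n\geq 1$; (ii) $X$ has integer-valued components. Then the support of $X$ has no gaps if and only if $P\{X=1\}>0$.
   Context: A real random variable $X$ is infinitely divisible (ID) if for every integer $n\geq 1$ there exist independent identically distributed random variables $X_{1n},\ldots,X_{nn}$ such that $X \overset{d}{=} X_{1n}+\cdots+X_{nn}$ (equality in distribution). The variables $X_{in}$ are called the components of $X$. $X$ has integer-valued components if, for every $n\geq 1$, the components $X_{1n},\ldots,X_{nn}$ are (almost surely) integer-valued. The support of a random variable is the smallest closed set carrying probability one; for $X$ on $I_0$ it is $\{j\in I_0: P\{X=j\}>0\}$. The support of $X$ has no gaps means that every non-negative integer carries positive probability, i.e. $P\{X=j\}>0$ for every $j\in I_0$. *)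

(* Defs.v *)
From HB Require Import structures.
From mathcomp Require Import all_boot all_order all_algebra.
From mathcomp Require Import all_classical all_reals all_analysis.

Set Implicit Arguments.
Unset Strict Implicit.
Unset Printing Implicit Defensive.

Import Order.TTheory GRing.Theory Num.Theory.
Import numFieldNormedType.Exports.

Local Open Scope classical_set_scope.
Local Open Scope ring_scope.

(* The two variables may live on different probability spaces. *)
Definition eq_in_distribution (R : realType)
    (d : measure_display) (T : measurableType d) (P : probability T R)
    (d' : measure_display) (T' : measurableType d') (Q : probability T' R)
    (X : T -> R) (Y : T' -> R) : Prop :=
  forall A : set R, measurable A -> P (X @^-1` A) = Q (Y @^-1` A).

Definition mutually_independent (R : realType)
    (d : measure_display) (T : measurableType d) (P : probability T R)
    (n : nat) (Y : 'I_n -> {RV P >-> R}) : Prop :=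
  forall (J : {set 'I_n}) (B : 'I_n -> set R),
    (forall i, measurable (B i)) ->
    P [set w | forall i, i \in J -> B i (Y i w)] =
    (\prod_(i in J) P (Y i @^-1` B i))%E.

Definition identically_distributed (R : realType)
    (d : measure_display) (T : measurableType d) (P : probability T R)
    (n : nat) (Y : 'I_n -> {RV P >-> R}) : Prop :=
  forall i j, eq_in_distribution P P (Y i) (Y j).

(* Y is the family (X_1n, ..., X_nn). *)
Definition are_components (R : realType)
    (d : measure_display) (T : measurableType d) (P : probability T R)
    (d' : measure_display) (T' : measurableType d') (Q : probability T' R)
    (X : {RV P >-> R}) (n : nat) (Y : 'I_n -> {RV Q >-> R}) : Prop :=
  [/\ mutually_independent Y, identically_distributed Y &
      eq_in_distribution P Q X (fun w => \sum_(i < n) Y i w)].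

Definition infinitely_divisible (R : realType)
    (d : measure_display) (T : measurableType d) (P : probability T R)
    (X : {RV P >-> R}) : Prop :=
  forall n : nat, (1 <= n)%N ->
    exists (d' : measure_display) (T' : measurableType d')
           (Q : probability T' R) (Y : 'I_n -> {RV Q >-> R}),
      are_components X Y.

(* On the real line this intersection itself carries probability one. *)
Definition support_of (R : realType)
    (d : measure_display) (T : measurableType d) (P : probability T R)
    (X : {RV P >-> R}) : set R :=
  \bigcap_(C in [set C : set R | closed C /\ P (X @^-1` C) = 1%E]) C.

(* The components live on an unspecified probability space, and only their
   common law is determined by X; hence the quantification over all of them. *)
Definition support_coincides_with_components (R : realType)
    (d : measure_display) (T : measurableType d) (P : probability T R)
    (X : {RV P >-> R}) : Prop :=
  forall n : nat, (1 <= n)%N ->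
    forall (d' : measure_display) (T' : measurableType d')
           (Q : probability T' R) (Y : 'I_n -> {RV Q >-> R}),
      are_components X Y -> forall i, support_of X = support_of (Y i).

Definition has_integer_valued_components (R : realType)
    (d : measure_display) (T : measurableType d) (P : probability T R)
    (X : {RV P >-> R}) : Prop :=
  forall n : nat, (1 <= n)%N ->
    forall (d' : measure_display) (T' : measurableType d')
           (Q : probability T' R) (Y : 'I_n -> {RV Q >-> R}),
      are_components X Y ->
      forall i, {ae Q, forall w, Y i w \is a Num.int}.

Definition nonneg_integer_valued (R : realType)
    (d : measure_display) (T : measurableType d) (P : probability T R)
    (X : {RV P >-> R}) : Prop :=
  {ae P, forall w, X w \is a Num.nat}.

Definition support_has_no_gaps (R : realType)
    (d : measure_display) (T : measurableType d) (P : probability T R)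
    (X : {RV P >-> R}) : Prop :=
  forall j : nat, (0 < P [set w | X w = j%:R%R])%E.

(* Main.v *)
Require Import Defs.
From HB Require Import structures.
From mathcomp Require Import all_boot all_order all_algebra.
From mathcomp Require Import all_classical all_reals all_analysis.
From mathcomp Require Import zify.

(** Let [Y_0, .., Y_(n-1)] be components of [X]. A sum of identically distributed
independent variables that is almost surely nonnegative has almost surely
nonnegative terms, since all terms are negative together with probability
[P(Y < 0) ^ n]. Hence, up to a null event, [X = 0] means that every [Y_i] is
zero, and [P(X = 0) = P(Y = 0) ^ n].

If [P(X = 0) > 0], then [Y] must be integer valued: otherwise, with positive
probability, one component is not an integer while all the others are zero.
Conversely, if all components are integer valued, choose [k] with [P(X = k) > 0]
and take [n = k + 1] components: were they never zero, their sum would be at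
least [k + 1] ([integer_components_zero_gt0]). If the supports of [X] and [Y]
agree, then [Y] almost surely lies in the support of [X], which consists of
integers, so this case reduces to the previous one.

The remaining point is that [P(X = 0) > 0] makes the supports of [X] and [Y]
equal ([pmf_components_gt0]). An atom of [Y] is an atom of [X], by letting the
other components be zero. For the converse, let [P(X = k) > 0], [k > 0], and
split [X] into [n * k] components distributed as [Z]. The generating functions
satisfy [y ^ n = (z ^ k) ^ n], and since the constant coefficients are positive,
[y = z ^ k] ([coef_exp_inj_low]): [Y] is distributed as a sum of [k] copies of
[Z]. Now [k] is a sum of [n * k] values of [Z], of which at most [k] are nonzero;
so it is a sum of [k] values of [Z] ([coef_exp_gt0_self]), hence a value of [Y].
This avoids the representation of [X] as a compound Poisson variable.

Finally, if [P(X = 1) > 0] then [1] is an atom of each of [j] components of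
[X], and all of them being equal to [1] gives [P(X = j) > 0].

The generating functions enter as polynomials truncated above the degree of
interest; [components_pmf] links them to the law of [X]. *)

Set Implicit Arguments.
Unset Strict Implicit.
Unset Printing Implicit Defensive.

Import Order.TTheory GRing.Theory Num.Theory.
Import numFieldNormedType.Exports.

Local Open Scope classical_set_scope.
Local Open Scope ring_scope.

(** * Low-order coefficients of powers of polynomials *)

(** Uniqueness of the [n]-th root of a truncated power series: [a ^ n - b ^ n]
factors as [a - b] times a cofactor whose constant coefficient is positive, and
such a cofactor can be cancelled modulo any power of the variable. *)
Lemma coef_exp_inj_low (R : realDomainType) (a b : {poly R}) (n K : nat) :
  (0 < n)%N -> 0 < a`_0 -> 0 < b`_0 ->
  (forall k, (k < K)%N -> (a ^+ n)`_k = (b ^+ n)`_k) ->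
  forall k, (k < K)%N -> a`_k = b`_k.
Proof.
move=> n0 a0 b0 eqn.
set c := \sum_(i < n) a ^+ (n.-1 - i) * b ^+ i.
have c0 : 0 < c`_0.
  rewrite -horner_coef0 horner_sum.
  case: n n0 @c eqn => // n _ _ _; rewrite big_ord_recl /= ltr_wpDr//.
    by apply: sumr_ge0 => i _;
      rewrite hornerM !horner_exp !horner_coef0 mulr_ge0// exprn_ge0// ltW.
  by rewrite hornerM !horner_exp !horner_coef0 mulr_gt0// exprn_gt0.
have dc k : (k < K)%N -> ((a - b) * c)`_k = 0.
  by move=> kK; rewrite -subrXX coefB eqn// subrr.
suff H k : (k < K)%N -> (a - b)`_k = 0.
  by move=> k /H; rewrite coefB => /eqP; rewrite subr_eq0 => /eqP.
elim/ltn_ind: k => k IH kK.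
have := dc _ kK; rewrite coefM big_ord_recr /= subnn big1 => [|i _].
  by rewrite add0r => /eqP; rewrite mulf_eq0 (gt_eqF c0) orbF => /eqP.
by rewrite IH ?mul0r// (ltn_trans _ kK).
Qed.

Lemma coef_exp_ge0 (R : realDomainType) (z : {poly R}) (m k : nat) :
  (forall j, 0 <= z`_j) -> 0 <= (z ^+ m)`_k.
Proof.
move=> z0; elim: m k => [|m IH] k; first by rewrite expr0 coef1 ler0n.
by rewrite exprS coefM; apply: sumr_ge0 => i _; exact: mulr_ge0.
Qed.

Lemma coef_expS_gt0 (R : realDomainType) (z : {poly R}) (m k : nat) :
  (forall j, 0 <= z`_j) ->
  reflect (exists j : 'I_k.+1, 0 < z`_j /\ 0 < (z ^+ m)`_(k - j))
          (0 < (z ^+ m.+1)`_k).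
Proof.
move=> z0; rewrite exprS coefM.
have s0 (i : 'I_k.+1) : 0 <= z`_i * (z ^+ m)`_(k - i).
  by apply: mulr_ge0 => //; exact: coef_exp_ge0.
apply: (iffP idP) => [|[j [zj mj]]]; last first.
  by rewrite (bigD1 j)//= ltr_wpDr ?mulr_gt0//; apply: sumr_ge0 => i _.
rewrite lt_def sumr_ge0// andbT psumr_neq0// => /hasP[j _] /= p0.
exists j; split; rewrite lt_def ?z0 ?coef_exp_ge0// andbT.
  by apply: contraTneq p0 => ->; rewrite mul0r ltxx.
by apply: contraTneq p0 => ->; rewrite mulr0 ltxx.
Qed.

Lemma coef_exp_gt0_le (R : realDomainType) (z : {poly R}) (m l k : nat) :
  (forall j, 0 <= z`_j) -> 0 < z`_0 -> (m <= l)%N ->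
  0 < (z ^+ m)`_k -> 0 < (z ^+ l)`_k.
Proof.
move=> zge0 z0 /subnK <-; elim: (l - m)%N => // i IH /IH pos.
by apply/coef_expS_gt0 => //; exists ord0; rewrite subn0.
Qed.

(** Among summands in [nat] adding up to [k], at most [k] are nonzero, and
vanishing summands can be dropped or added freely when [z] has a constant
term. *)
Lemma coef_exp_gt0_self (R : realDomainType) (z : {poly R}) (m k : nat) :
  (forall j, 0 <= z`_j) -> 0 < z`_0 ->
  0 < (z ^+ m)`_k -> 0 < (z ^+ k)`_k.
Proof.
move=> zge0 z0; elim: m k => [|m IH] k.
  by rewrite expr0 coef1; case: k => [|k]; rewrite /= ?ltxx// expr0 coef1.
case/coef_expS_gt0 => // j [zj mj].
have [j0|j0] := posnP j; first by apply: IH; rewrite -[k]subn0 -j0.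
apply: (@coef_exp_gt0_le _ _ (k - j).+1) => //; last first.
  by apply/coef_expS_gt0 => //; exists j; split=> //; exact: IH.
by have := ltn_ord j; lia.
Qed.

(** If [z] has no constant term, [z ^ m] is divisible by the [m]-th power of the
variable. *)
Lemma coef_exp_gt0_root0 (R : realDomainType) (z : {poly R}) (m k : nat) :
  (forall j, 0 <= z`_j) -> z`_0 = 0 -> 0 < (z ^+ m)`_k -> (m <= k)%N.
Proof.
move=> zge0 z0; elim: m k => // m IH k /coef_expS_gt0-/(_ zge0)[j [zj /IH mkj]].
have j0 : (0 < j)%N.
  by rewrite lt0n; apply: contraTneq zj => ->; rewrite z0 ltxx.
by have jk := ltn_ord j; lia.
Qed.

(** For [q] a probability mass function this is the law of a sum of [n]
independent variables, spelled out over all the values of the summands. *)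
Lemma coef_poly_exp (R : comNzRingType) (q : nat -> R) (n K k : nat) :
  ((\poly_(j < K) q j) ^+ n)`_k =
  \sum_(f : {ffun 'I_n -> 'I_K} | (\sum_i f i == k)%N) \prod_i q (f i).
Proof.
rewrite -[in LHS](card_ord n) -prodr_const poly_def.
rewrite (bigA_distr_bigA (fun (_ : 'I_n) (j : 'I_K) => q j *: 'X^j)) coef_sum.
rewrite [RHS]big_mkcond; apply: eq_bigr => f _.
rewrite scaler_prod prodrXr/= coefZ coefXn eq_sym.
by case: eqP => _; rewrite ?mulr1 ?mulr0.
Qed.

(** * Almost sure statements about real random variables *)

(** Near any point, such a set coincides with a finite one. *)
Lemma closed_nat_subset (R : realType) (S : set R) :
  S `<=` [set x | x \is a Num.nat] -> closed S.
Proof.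
move=> Snat; rewrite -[S]setCK closedC openE => x Sx.
(* The elements of [S] below [N] form a finite set, and [N] exceeds [x]. *)
set N := (Num.truncn x).+1.
set F := [set k%:R | k in `I_N] `&` S.
have finF : finite_set F by apply: finite_setIl; exact: finite_image.
have oF : open (~` F).
  rewrite openC; apply: (proj1 accessible_finite_set_closed) => //.
  exact/hausdorff_accessible/norm_hausdorff.
have xF : (~` F) x by move=> [].
have xN : x < N%:R.
  by rewrite truncnS_gt.
have nx : nbhs x (~` F `&` [set y | y < N%:R]).
  by apply: filterI; [exact: open_nbhs_nbhs|exact: lt_nbhsl].
apply: filterS nx => y /= [yF yN] Sy; apply: yF; split => //.
have /natrP[k yk] := Snat _ Sy.
by exists k; rewrite ?yk// /= -(ltr_nat R) -yk.
Qed.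

Lemma measurable_nat_subset (R : realType) (S : set R) :
  S `<=` [set x | x \is a Num.nat] -> measurable S.
Proof. by move=> /closed_nat_subset/measurable_realfun.closed_measurable. Qed.

Lemma ae_le_measure (d : measure_display) (T : measurableType d) (R : realType)
    (mu : {measure set T -> \bar R}) (A B : set T) :
  measurable A -> measurable B -> {ae mu, forall w, A w -> B w} ->
  (mu A <= mu B)%E.
Proof.
move=> mA mB AB.
have D0 : mu (A `\` B) = 0%E.
  apply/negligibleP; first exact: measurableD.
  by apply: negligibleS AB => w /= [Aw nBw] /(_ Aw).
rewrite -(measureU0 mB (measurableD mA mB) D0).
apply: le_measure; rewrite ?inE//.
  by apply: measurableU => //; exact: measurableD.
by move=> w Aw; have [Bw|nBw] := pselect (B w); [left|right].
Qed.

Lemma ae_preimage (d : measure_display) (T : measurableType d) (R : realType)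
    (P : probability T R) (X : {RV P >-> R}) (A : set R) :
  measurable A -> {ae P, forall w, A (X w)} <-> P (X @^-1` (~` A)) = 0%E.
Proof.
move=> mA; apply: negligibleP; exact: measurable_funPTI (measurableC mA).
Qed.

Lemma measurable_sum_preimage (d : measure_display) (T : measurableType d)
    (R : realType) (P : probability T R) (n : nat) (Y : 'I_n -> {RV P >-> R})
    (A : set R) :
  measurable A -> measurable ((fun w => \sum_(i < n) Y i w) @^-1` A).
Proof.
move=> mA; rewrite -[X in measurable X]setTI.
by apply: measurable_sum => // i; exact: measurable_funPT.
Qed.

(** * Sign and integrality of the components *)

Lemma components_sum_ae (R : realType)
    (d : measure_display) (T : measurableType d) (P : probability T R)
    (d' : measure_display) (T' : measurableType d') (Q : probability T' R)
    (X : {RV P >-> R}) (n : nat) (Y : 'I_n -> {RV Q >-> R}) (A : set R) :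
  are_components X Y -> measurable A -> {ae P, forall w, A (X w)} ->
  {ae Q, forall w, A (\sum_(i < n) Y i w)}.
Proof.
move=> [_ _ XY] mA /ae_preimage-/(_ mA) XA.
apply/negligibleP; first exact: measurable_sum_preimage (measurableC mA).
by have := XY _ (measurableC mA); rewrite XA => /esym.
Qed.

(** Independence for the full index set, with every factor expressed through the
law of a single component [Y i]; the real-valued product is what the algebraic
lemmas need. *)
Lemma components_joint (R : realType)
    (d : measure_display) (T : measurableType d) (P : probability T R)
    (d' : measure_display) (T' : measurableType d') (Q : probability T' R)
    (X : {RV P >-> R}) (n : nat) (Y : 'I_n -> {RV Q >-> R}) (i : 'I_n)
    (B : 'I_n -> set R) :
  are_components X Y -> (forall j, measurable (B j)) ->
  measurable [set w | forall j, B j (Y j w)] /\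
  Q [set w | forall j, B j (Y j w)] =
    (\prod_(j < n) fine (Q (Y i @^-1` B j)))%:E.
Proof.
move=> [indY idY _] mB; split.
  rewrite (_ : [set _ | _] = \bigcap_(j in [set: 'I_n]) (Y j @^-1` B j)).
    by apply: fin_bigcap_measurable => // j _; exact: measurable_funPTI.
  by apply/seteqP; split => w /= H j; [move=> _|]; exact: H.
rewrite -prodEFin.
rewrite (_ : mkset _ = [set w | forall j, j \in [set: 'I_n]%SET -> B j (Y j w)]).
  rewrite indY//; apply: eq_big => [j|j _]; rewrite ?inE//.
  by rewrite fineK ?fin_num_measure//; [exact: idY|exact: measurable_funPTI].
by apply/seteqP; split => w /= H j; [move=> _|]; apply: H; rewrite ?inE.
Qed.

(** All components are negative simultaneously with probability [P(Y < 0) ^ n],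
and then so is their sum. *)
Lemma components_ge0 (R : realType)
    (d : measure_display) (T : measurableType d) (P : probability T R)
    (d' : measure_display) (T' : measurableType d') (Q : probability T' R)
    (X : {RV P >-> R}) (n : nat) (Y : 'I_n -> {RV Q >-> R}) :
  nonneg_integer_valued X -> are_components X Y ->
  forall i, {ae Q, forall w, 0 <= Y i w}.
Proof.
move=> Xnat XY i.
have mge0 : measurable [set x : R | 0 <= x].
  by rewrite -set_itvcy; exact: measurable_itv.
have Sge0 : {ae Q, forall w, 0 <= \sum_(j < n) Y j w}.
  apply: (components_sum_ae XY mge0).
  by apply: filterS Xnat => w; exact: natr_ge0.
apply/(ae_preimage _ mge0).
have [mneg jneg] := components_joint i XY (fun=> measurableC mge0).
have : Q [set w | forall j, ~ 0 <= Y j w] = 0%E.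
  apply/negligibleP => //; apply: negligibleS Sge0 => w /= neg Sw.
  suff : \sum_(j < n) Y j w < 0 by rewrite ltNge Sw.
  rewrite -[ltRHS](@big1_eq _ _ +%R _ (index_enum 'I_n) predT).
  apply: ltr_sum => [|j _]; first by apply/hasP; exists i; rewrite ?mem_index_enum.
  by rewrite ltNge; apply/negP.
have mY := measurable_funPTI (Y i) (measurableC mge0).
rewrite jneg => -[/eqP]; rewrite prodf_seq_eq0 => /hasP[j _ /= /eqP f0].
by rewrite -[LHS]fineK ?fin_num_measure// f0.
Qed.

(** A sum of nonnegative terms vanishes only if all of them do, so that
[P(X = 0) = P(Y = 0) ^ n]. *)
Lemma components_zero_gt0 (R : realType)
    (d : measure_display) (T : measurableType d) (P : probability T R)
    (d' : measure_display) (T' : measurableType d') (Q : probability T' R)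
    (X : {RV P >-> R}) (n : nat) (Y : 'I_n -> {RV Q >-> R}) :
  nonneg_integer_valued X -> (0 < P [set w | X w = 0%R])%E ->
  are_components X Y -> forall i, (0 < Q [set w | Y i w = 0%R])%E.
Proof.
move=> Xnat X0 XY i.
have m0 : measurable [set (0 : R)] by exact: measurable_set1.
have [mz jz] := components_joint i XY (fun=> m0).
have mY := measurable_funPTI (Y i) m0.
rewrite lt0e measure_ge0 andbT; apply/eqP => Y0.
suff : (P (X @^-1` [set 0%R]) <= 0)%E by rewrite leNgt X0.
have -> : 0%E = Q [set w | forall j, [set 0] (Y j w)] :> \bar R.
  by rewrite jz (bigD1 i)//= [Q _]Y0/= mul0r.
have [_ _ ->//] := XY; apply: ae_le_measure => //.
  exact: measurable_sum_preimage.
have : \forall w \ae Q, forall j, 0 <= Y j w.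
  by apply: filter_forall; exact: components_ge0 XY.
by apply: filterS => w Yge0 /= S0 j; apply: (psumr_eq0P _ S0).
Qed.

(** When all the other components are zero, which has positive probability, the
sum is the remaining component. *)
Lemma components_nat (R : realType)
    (d : measure_display) (T : measurableType d) (P : probability T R)
    (d' : measure_display) (T' : measurableType d') (Q : probability T' R)
    (X : {RV P >-> R}) (n : nat) (Y : 'I_n -> {RV Q >-> R}) :
  nonneg_integer_valued X -> (0 < P [set w | X w = 0%R])%E ->
  are_components X Y -> forall i, nonneg_integer_valued (Y i).
Proof.
move=> Xnat X0 XY i.
have mN : measurable [set x : R | x \is a Num.nat].
  exact: measurable_nat_subset.
have m0 : measurable [set (0 : R)] by exact: measurable_set1.
apply/(ae_preimage _ mN).
set B := fun j => if j == i then ~` [set x : R | x \is a Num.nat] else [set 0].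
have mB j : measurable (B j).
  by rewrite /B; case: ifP => // _; exact: measurableC.
have [mz jz] := components_joint i XY mB.
have : Q [set w | forall j, B j (Y j w)] = 0%E.
  apply/negligibleP => //.
  apply: negligibleS (components_sum_ae XY mN Xnat) => w /= Bw.
  rewrite (bigD1 i)//= big1 ?addr0 => [|j ji].
    by have := Bw i; rewrite /B eqxx.
  by have := Bw j; rewrite /B (negbTE ji).
rewrite jz => -[/eqP]; rewrite prodf_seq_eq0 => /hasP[j _ /= /eqP].
have mY A : measurable A -> Q (Y i @^-1` A) \is a fin_num.
  by move=> mA; rewrite fin_num_measure//; exact: measurable_funPTI.
rewrite /B; case: eqP => _ f0.
  by rewrite -[LHS]fineK ?mY ?f0//; exact: measurableC.
have Y0 : Q (Y i @^-1` [set 0]) = 0%E by rewrite -[LHS]fineK ?mY// f0.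
by have := components_zero_gt0 Xnat X0 XY i; rewrite lt0e => /andP[/eqP/(_ Y0)].
Qed.

(** * Generating functions of the components *)

(** Cutting off at degree [K] makes the generating function a polynomial without
affecting the coefficients of degree less than [K] of its powers. *)
Definition truncated_pgf (R : realType)
    (d : measure_display) (T : measurableType d) (P : probability T R)
    (X : {RV P >-> R}) (K : nat) : {poly R} :=
  \poly_(k < K) pmf X k%:R.

Lemma pmf_gt0 (R : realType)
    (d : measure_display) (T : measurableType d) (P : probability T R)
    (X : {RV P >-> R}) (r : R) :
  (0 < pmf X r) = (0 < P [set w | X w = r])%E.
Proof.
by rewrite -lte_fin fineK// fin_num_measure.
Qed.

Lemma truncated_pgf_ge0 (R : realType)
    (d : measure_display) (T : measurableType d) (P : probability T R)
    (X : {RV P >-> R}) (K k : nat) :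
  0 <= (truncated_pgf X K)`_k.
Proof. by rewrite coef_poly; case: ifP => // _; exact: pmf_ge0. Qed.

(** The event that the sum is [k] splits, up to a null event, according to the
values of the components, all of which are at most [k]. *)
Lemma components_pmf (R : realType)
    (d : measure_display) (T : measurableType d) (P : probability T R)
    (d' : measure_display) (T' : measurableType d') (Q : probability T' R)
    (X : {RV P >-> R}) (n : nat) (Y : 'I_n -> {RV Q >-> R}) (i : 'I_n)
    (K k : nat) :
  are_components X Y -> (forall j, nonneg_integer_valued (Y j)) ->
  (k < K)%N -> pmf X k%:R = (truncated_pgf (Y i) K ^+ n)`_k.
Proof.
move=> XY Ynat kK; rewrite coef_poly_exp.
pose E (f : {ffun 'I_n -> 'I_K}) := [set w | forall j, Y j w = (f j)%:R].
have mE f : measurable (E f) /\ Q (E f) = (\prod_j pmf (Y i) (f j)%:R)%:E.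
  exact: (components_joint i XY (fun j => measurable_set1 (f j)%:R)).
pose p := [pred f : {ffun 'I_n -> 'I_K} | (\sum_j f j == k)%N].
pose U := \bigcup_(f in [set` enum p]) E f.
have mU : measurable U by apply: fin_bigcup_measurable => // f _; exact: (mE f).1.
have QU : Q U = (\sum_(f | p f) \prod_j pmf (Y i) (f j)%:R)%:E.
  rewrite measure_fin_bigcup//.
  - rewrite -fsbig_seq ?enum_uniq// big_enum/= -sumEFin.
    by apply: eq_bigr => f _; exact: (mE f).2.
  - move=> f g _ _ [w [wf wg]]; apply/ffunP => j; apply/val_inj/eqP.
    by rewrite -(eqr_nat R) -wf -wg.
  - by move=> f _; exact: (mE f).1.
have [_ _ XS] := XY.
have mk : measurable [set (k%:R : R)] by exact: measurable_set1.
have mS := measurable_sum_preimage Y mk.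
rewrite /pmf (XS _ mk) (_ : Q _ = (\sum_(f | p f) \prod_j pmf (Y i) (f j)%:R)%:E)//.
rewrite -QU; apply/eqP; rewrite eq_le; apply/andP; split; apply: ae_le_measure => //.
  have : \forall w \ae Q, forall j, Y j w \is a Num.nat by exact: filter_forall.
  apply: filterS => w Yw /= Sk.
  have Yt j : Y j w = (Num.truncn (Y j w))%:R by rewrite truncnK.
  have Stk : (\sum_j Num.truncn (Y j w) = k)%N.
    apply/eqP; rewrite -(eqr_nat R) -Sk natr_sum; apply/eqP.
    by apply: eq_bigr => j _.
  have tK j : (Num.truncn (Y j w) < K)%N.
    by rewrite (leq_ltn_trans _ kK)// -Stk (bigD1 j)//= leq_addr.
  exists [ffun j => Ordinal (tK j)] => /=; last by move=> j; rewrite ffunE.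
  by rewrite /= mem_enum inE/= -[X in _ == X]Stk; apply/eqP/eq_bigr => j _;
    rewrite ffunE.
apply: aeW => w [f /=]; rewrite mem_enum inE => /eqP <- Ef; rewrite /= natr_sum.
by apply: eq_bigr => j _; exact: Ef.
Qed.

(** [Y] is distributed as a sum of [m] copies of [Z], since the generating
function of [X] has only one [n]-th root with positive constant coefficient. *)
Lemma components_truncated_pgf_eq (R : realType)
    (d : measure_display) (T : measurableType d) (P : probability T R)
    (d1 : measure_display) (T1 : measurableType d1) (Q1 : probability T1 R)
    (d2 : measure_display) (T2 : measurableType d2) (Q2 : probability T2 R)
    (X : {RV P >-> R}) (m n : nat)
    (Y : 'I_n -> {RV Q1 >-> R}) (Z : 'I_(n * m) -> {RV Q2 >-> R})
    (i : 'I_n) (j : 'I_(n * m)) (k : nat) :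
  nonneg_integer_valued X -> (0 < P [set w | X w = 0%R])%E ->
  are_components X Y -> are_components X Z ->
  pmf (Y i) k%:R = (truncated_pgf (Z j) k.+1 ^+ m)`_k.
Proof.
move=> Xnat X0 XY XZ.
have Yk : pmf (Y i) k%:R = (truncated_pgf (Y i) k.+1)`_k by rewrite coef_poly ltnSn.
have n0 : (0 < n)%N := leq_ltn_trans (leq0n i) (ltn_ord i).
rewrite Yk; apply: (@coef_exp_inj_low _ _ _ n k.+1) => //.
- rewrite coef_poly/= pmf_gt0; exact: (components_zero_gt0 Xnat X0 XY).
- rewrite -horner_coef0 hornerE exprn_gt0// horner_coef0 coef_poly pmf_gt0.
  exact: (components_zero_gt0 Xnat X0 XZ).
- move=> l lk; rewrite -exprM (mulnC m).
  rewrite -(components_pmf i XY (components_nat Xnat X0 XY) lk).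
  by rewrite -(components_pmf j XZ (components_nat Xnat X0 XZ) lk).
Qed.

(** * Supports *)

(** Every atom of [Y] is an atom of [X] because the other components may vanish.
Conversely, an atom [k > 0] of [X] is a sum of values of the components [Z] of a
division of [X] into [n * k] parts; at most [k] of them are nonzero, and [Y] is
distributed as a sum of [k] copies of [Z]. *)
Lemma pmf_components_gt0 (R : realType)
    (d : measure_display) (T : measurableType d) (P : probability T R)
    (d' : measure_display) (T' : measurableType d') (Q : probability T' R)
    (X : {RV P >-> R}) (n : nat) (Y : 'I_n -> {RV Q >-> R})
    (i : 'I_n) (k : nat) :
  nonneg_integer_valued X -> infinitely_divisible X ->
  (0 < P [set w | X w = 0%R])%E -> are_components X Y ->
  (0 < pmf X k%:R) = (0 < pmf (Y i) k%:R).
Proof.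
move=> Xnat XID X0 XY.
have n0 : (0 < n)%N := leq_ltn_trans (leq0n i) (ltn_ord i).
have Y0 : 0 < (truncated_pgf (Y i) k.+1)`_0.
  by rewrite coef_poly/= pmf_gt0; exact: (components_zero_gt0 Xnat X0 XY).
have YE : (truncated_pgf (Y i) k.+1)`_k = pmf (Y i) k%:R by rewrite coef_poly ltnSn.
have Ynat := components_nat Xnat X0 XY.
apply/idP/idP => [Xk|Yk]; last first.
  rewrite (components_pmf i XY Ynat (ltnSn k)).
  apply: (@coef_exp_gt0_le _ _ 1) => //; first exact: truncated_pgf_ge0.
  by rewrite expr1 YE.
have [k0|k0] := posnP k.
  by rewrite k0 pmf_gt0; exact: (components_zero_gt0 Xnat X0 XY).
have nk0 : (0 < n * k)%N by rewrite muln_gt0 n0.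
have [d2 [T2 [Q2 [Z XZ]]]] := XID _ nk0.
pose j := Ordinal nk0.
have Znat := components_nat Xnat X0 XZ.
rewrite (components_truncated_pgf_eq i j k Xnat X0 XY XZ).
apply: (@coef_exp_gt0_self _ _ (n * k)); first exact: truncated_pgf_ge0.
- by rewrite coef_poly/= pmf_gt0; exact: (components_zero_gt0 Xnat X0 XZ).
- by rewrite -(components_pmf j XZ).
Qed.

Lemma nat_valued_atom (R : realType)
    (d : measure_display) (T : measurableType d) (P : probability T R)
    (X : {RV P >-> R}) :
  nonneg_integer_valued X -> exists k : nat, 0 < pmf X k%:R.
Proof.
move=> Xnat; apply/not_existsP => noatom.
have : P.-negligible setT.
  apply: (@negligibleS _ _ _ _ (~` [set w | X w \is a Num.nat] `|`
     \bigcup_k (X @^-1` [set k%:R]))).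
    move=> w _; have [/natrP[k Xk]|nX] := pselect (X w \is a Num.nat).
      by right; exists k.
    by left.
  apply: negligibleU => //; apply: negligible_bigcup => k.
  apply/negligibleP; first exact: measurable_funPTI (measurable_set1 _).
  by have := noatom k; rewrite pmf_gt0 lt0e measure_ge0 andbT => /negP/negPn/eqP.
move=> /negligibleP-/(_ measurableT) P0.
by have := probability_setT P; rewrite [P _]P0 => /esym/eqP; rewrite onee_eq0.
Qed.

(** If [k] is an atom of [X], a division of [X] into [k + 1] components that are
almost surely positive integers would force [X] to be at least [k + 1]. *)
Lemma integer_components_zero_gt0 (R : realType)
    (d : measure_display) (T : measurableType d) (P : probability T R)
    (X : {RV P >-> R}) :
  nonneg_integer_valued X -> infinitely_divisible X ->
  has_integer_valued_components X -> (0 < P [set w | X w = 0%R])%E.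
Proof.
move=> Xnat XID Xint; have [k Xk] := nat_valued_atom Xnat.
have [d' [T' [Q [Y XY]]]] := XID k.+1 isT.
have Ynat j : nonneg_integer_valued (Y j).
  have := Xint k.+1 isT _ _ _ _ XY j; have := components_ge0 Xnat XY j.
  by apply: filterS2 => w; rewrite natrEint => -> ->.
have Zge0 := truncated_pgf_ge0 (Y ord0) k.+1.
have p0 : pmf X 0%:R = (truncated_pgf (Y ord0) k.+1 ^+ k.+1)`_0.
  exact: (components_pmf ord0 XY Ynat (ltn0Sn k)).
rewrite -pmf_gt0 p0 -horner_coef0 hornerE exprn_gt0// horner_coef0.
rewrite lt_def Zge0 andbT; apply/eqP => Y0.
move: Xk; rewrite (components_pmf ord0 XY Ynat (ltnSn k)).
by move=> /(coef_exp_gt0_root0 Zge0 Y0); rewrite ltnn.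
Qed.

(** The complement of the support is a union of null open sets, hence also of null
intervals with rational endpoints, of which there are countably many. *)
Lemma support_of_ae (R : realType)
    (d : measure_display) (T : measurableType d) (P : probability T R)
    (X : {RV P >-> R}) :
  {ae P, forall w, support_of X (X w)}.
Proof.
pose J (q : rat * rat) : set R := `]ratr q.1, ratr q.2[%classic.
pose N (k : nat) : set T := if unpickle k is Some q then
  if P (X @^-1` (J q)) == 0%E then X @^-1` (J q) else set0 else set0.
have N0 : P.-negligible (\bigcup_k N k).
  apply: negligible_bigcup => k; rewrite /N.
  case: unpickle => [q|]; last exact: negligible_set0.
  case: eqP => [J0|_]; last exact: negligible_set0.
  apply/negligibleP => //.
  by apply: measurable_funPTI; rewrite /J; exact: measurable_itv.
apply: negligibleS N0 => w /= /existsNP[C /not_implyP[[cC C1] nC]].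
have oC : open (~` C) by rewrite openC.
have /nbhs_ballP[e /= e0 eC] : nbhs (X w) (~` C) by exact: open_nbhs_nbhs.
have /rat_in_itvoo[a] : X w - e < X w by rewrite ltrBlDr ltrDl.
rewrite in_itv/= => /andP[ea aX].
have /rat_in_itvoo[b] : X w < X w + e by rewrite ltrDl.
rewrite in_itv/= => /andP[Xb be].
exists (pickle (a, b)); first exact: I.
rewrite /N pickleK.
have mC : measurable C by exact: measurable_realfun.closed_measurable.
have mJ : measurable (J (a, b)) by exact: measurable_itv.
have -> : P (X @^-1` J (a, b)) = 0%E.
  apply/eqP; rewrite -measure_le0.
  have <- : P (X @^-1` (~` C)) = 0%E.
    by rewrite preimage_setC probability_setC ?C1 ?subee//; exact: measurable_funPTI.
  apply: le_measure; rewrite ?inE.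
  - exact: measurable_funPTI.
  - exact: measurable_funPTI (measurableC mC).
  - move=> v; rewrite /J/= in_itv/= => /andP[av vb]; apply: eC.
    by rewrite /ball/= ltr_distlC (lt_trans ea av) (lt_trans vb be).
by rewrite eqxx /J /= in_itv/= aX Xb.
Qed.

(** The set of atoms carries probability one and is closed, as a set of natural
numbers; no closed set of probability one can miss an atom. *)
Lemma support_of_nat_valued (R : realType)
    (d : measure_display) (T : measurableType d) (P : probability T R)
    (X : {RV P >-> R}) :
  nonneg_integer_valued X ->
  support_of X = [set k%:R | k in [set k : nat | 0 < pmf X k%:R]].
Proof.
move=> Xnat; apply/seteqP; split => x.
  set S := [set _ | _ in _] => supp; apply: (supp S); split.
    by apply: closed_nat_subset => _ [k _ <-] /=.
  have mS : measurable S by apply: measurable_nat_subset => _ [k _ <-] /=.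
  suff : {ae P, forall w, S (X w)}.
    move=> /(ae_preimage _ mS) S0; rewrite -[S]setCK preimage_setC.
    rewrite probability_setC ?S0 ?sube0//.
    exact: measurable_funPTI (measurableC mS).
  have : \forall w \ae P, forall k : nat, X w = k%:R -> 0 < pmf X k%:R.
    apply/ae_foralln => k; have [Xk|Xk] := pselect (0 < pmf X k%:R).
      exact: aeW.
    apply: (@negligibleS _ _ _ _ (X @^-1` [set k%:R])).
      by move=> w /= /not_implyP[].
    apply/negligibleP; first exact: measurable_funPTI (measurable_set1 _).
    by move: Xk; rewrite pmf_gt0 lt0e measure_ge0 andbT => /negP/negPn/eqP.
  by apply: filterS2 Xnat => w /natrP[k Xk] /(_ _ Xk) pk; exists k.
move=> [k /= Xk <-] C [cC C1]; apply: contrapT => nC.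
have mC : measurable C by exact: measurable_realfun.closed_measurable.
suff : (P (X @^-1` [set k%:R]) <= 0)%E by rewrite leNgt -pmf_gt0 Xk.
have <- : P (X @^-1` (~` C)) = 0%E.
  by rewrite preimage_setC probability_setC ?C1 ?subee//; exact: measurable_funPTI.
apply: le_measure; rewrite ?inE.
- exact: measurable_funPTI (measurable_set1 _).
- exact: measurable_funPTI (measurableC mC).
- by move=> w /= ->.
Qed.

(** * Divisibility, supports and gaps *)

Theorem theorem5 (R : realType)
    (d : measure_display) (T : measurableType d) (P : probability T R)
    (X : {RV P >-> R})
    (hX : nonneg_integer_valued X)
    (hID : infinitely_divisible X) :
  [/\ (0 < P [set w | X w = 0%R])%E <-> support_coincides_with_components X,
      (0 < P [set w | X w = 0%R])%E <-> has_integer_valued_components X &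
      [\/ (0 < P [set w | X w = 0%R])%E,
          support_coincides_with_components X |
          has_integer_valued_components X] ->
      (support_has_no_gaps X <-> (0 < P [set w | X w = 1%R])%E)].
Proof.
have int_pos := integer_components_zero_gt0 hX hID.
have supp_int : support_coincides_with_components X ->
    has_integer_valued_components X.
  move=> supp n n0 d' T' Q Y XY i.
  apply: filterS (support_of_ae (Y i)) => w.
  rewrite -(supp _ n0 _ _ _ _ XY i) (support_of_nat_valued hX) => -[k _ <-].
  by rewrite natr_int.
have pos_int : (0 < P [set w | X w = 0%R])%E -> has_integer_valued_components X.
  move=> X0 n _ d' T' Q Y XY i.
  by apply: filterS (components_nat hX X0 XY i) => w; exact: intr_nat.
have pos_supp : (0 < P [set w | X w = 0%R])%E ->
    support_coincides_with_components X.
  move=> X0 n _ d' T' Q Y XY i.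
  rewrite (support_of_nat_valued hX).
  rewrite (support_of_nat_valued (components_nat hX X0 XY i)).
  by congr image; apply/seteqP; split => k /=;
    rewrite (pmf_components_gt0 i k hX hID X0 XY).
split; [by split=> // /supp_int|by []|].
move=> cond.
have X0 : (0 < P [set w | X w = 0%R])%E by case: cond => // /supp_int.
split=> [/(_ 1%N)//|X1 [//|k]].
have [d' [T' [Q [Y XY]]]] := hID k.+1 isT.
have Ynat := components_nat hX X0 XY.
rewrite -pmf_gt0 (components_pmf ord0 XY Ynat (ltnSn _)).
have Y1 : 0 < (truncated_pgf (Y ord0) k.+2)`_1.
  by rewrite coef_poly/= -(pmf_components_gt0 ord0 1 hX hID X0 XY) pmf_gt0.
have Yge0 := truncated_pgf_ge0 (Y ord0) k.+2.
(* All [k.+1] components may be equal to 1 at the same time. *)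
move: (truncated_pgf _ _) Y1 Yge0 => z z1 zge0.
elim: (k.+1) => [|m IH]; first by rewrite expr0 coef1.
apply/coef_expS_gt0 => //.
by exists (lift ord0 ord0); rewrite /= subn1.
Qed.
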